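(* Let $H$ be a nonzero real Hilbert space, $1<p\le 2$ and $\tau>0$. (i) Let $(\Omega,\mathcal{F},\mathbb{P})$ be a probability space, let $X\in L^p(\Omega;H)$, and write $Y=C_\tau(X)$, $m=\mathbb{E}X$, $b=\mathbb{E}Y$. Then for all deterministic $\alpha,\beta\ge 0$, $$\alpha\lVert b-m\rVert+\frac{\beta}{\tau}\,\mathbb{E}\lVert Y-b\rVert^2\le K_p(\alpha,\beta)\,\tau^{1-p}\,\mathbb{E}\lVert X\rVert^p .$$ (ii) For all $\alpha,\beta\ge 0$, $$\sup_{\substack{\mathbb{E}X=0\\ 0<\mathbb{E}\lVert X\rVert^p<\infty}}\frac{\alpha\lVert\mathbb{E}C_\tau(X)\rVert+\beta\tau^{-1}\,\mathbb{E}\lVert C_\tau(X)-\mathbb{E}C_\tau(X)\rVert^2}{\tau^{1-p}\,\mathbb{E}\lVert X\rVert^p}=K_p(\alpha,\beta),$$ where the supremum is taken over all strongly measurable $H$-valued random variables $X$, defined on arbitrary probability spaces, that satisfy $\mathbb{E}X=0$ and $0<\mathbb{E}\lVert X\rVert^p<\infty$. Moreover, finite two-point probability spaces suffice: the supremum restricted to such $X$ defined on two-point probability spaces is already equal to $K_p(\alpha,\beta)$. (iii) If $\alpha>p\beta$ (with $\alpha,\beta\ge0$), the supremum in (ii) is not attained by any $X$ with $\mathbb{E}X=0$ and $0<\mathbb{E}\lVert X\rVert^p<\infty$.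
   Context: $L^p(\Omega;H)$ denotes the Bochner space, and all $H$-valued expectations are Bochner expectations. For $\tau>0$, radial clipping is the map $C_\tau:H\to H$ with $C_\tau(x)=x$ if $\lVert x\rVert\le\tau$ and $C_\tau(x)=\tau x/\lVert x\rVert$ if $\lVert x\rVert>\tau$. For $1<p\le 2$ put $c_p=\dfrac{(p-1)^{p-1}}{p^p}$. For $\alpha,\beta\ge 0$ define $$K_p(\alpha,\beta)=\begin{cases}\beta,&\alpha\le p\beta,\\ c_p\,\dfrac{\alpha^p}{(\alpha-\beta)^{p-1}},&\alpha>p\beta.\end{cases}$$ *)

(* Defs.v *)
From HB Require Import structures.
From mathcomp Require Import all_boot all_order all_algebra.
From mathcomp Require Import sesquilinear.
From mathcomp Require Import all_classical all_reals all_analysis.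

Set Implicit Arguments.
Unset Strict Implicit.
Unset Printing Implicit Defensive.

Import Order.TTheory GRing.Theory Num.Theory.
Import numFieldNormedType.Exports.

Local Open Scope classical_set_scope.
Local Open Scope ring_scope.

(* Together with the completeness of [H], this makes [H] a real Hilbert space
   with inner product [dot]. *)
Definition hilbert_dot (R : realType) (H : completeNormedModType R)
    (dot : {dot H for idfun}) : Prop :=
  forall x : H, `|x| = Num.sqrt (dot x x).

Section Bochner.
Context (R : realType) (H : completeNormedModType R).
Context d (T : measurableType d).

(* [{sfun T >-> _}] only covers real-valued functions. *)
Definition simple_function (s : T -> H) : Prop :=
  finite_set (range s) /\ forall h : H, measurable (s @^-1` [set h]).

(* The simple functions converge at every point, and not only almost
   everywhere; every class in the Bochner space L^p has such a
   representative. *)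
Definition strongly_measurable (X : T -> H) : Prop :=
  exists s : (T -> H)^nat,
    (forall n, simple_function (s n)) /\
    forall w, s n w @[n --> \oo] --> X w.

Definition simple_expectation (P : probability T R) (s : T -> H) : H :=
  \sum_(h \in range s) fine (P (s @^-1` [set h])) *: h.

Definition is_bochner_expectation (P : probability T R) (X : T -> H) (m : H)
    : Prop :=
  strongly_measurable X /\
  exists s : (T -> H)^nat,
    [/\ forall n, simple_function (s n),
        ('E_P[(fun w => `|X w - s n w|)%R])%E @[n --> \oo] --> 0%E
      & simple_expectation P (s n) @[n --> \oo] --> m].

(* Equal to 0 when [X] is not Bochner integrable. *)
Definition bochner_expectation (P : probability T R) (X : T -> H) : H :=
  xget 0 [set m | is_bochner_expectation P X m].

Definition moment (P : probability T R) (p : R) (X : T -> H) : \bar R :=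
  ('E_P[(fun w => `|X w| `^ p)%R])%E.

Definition in_bochner_Lp (P : probability T R) (p : R) (X : T -> H) : Prop :=
  strongly_measurable X /\ (moment P p X < +oo)%E.

End Bochner.

Definition clip (R : realType) (H : completeNormedModType R) (tau : R) (x : H)
    : H :=
  if `|x| <= tau then x else (tau / `|x|) *: x.

Definition c_ (R : realType) (p : R) : R :=
  (p - 1) `^ (p - 1) / p `^ p.

Definition K_ (R : realType) (p alpha beta : R) : R :=
  if alpha <= p * beta then beta
  else c_ p * alpha `^ p / (alpha - beta) `^ (p - 1).

Section ClippingRatio.
Context (R : realType) (H : completeNormedModType R).
Variables (p tau alpha beta : R).
Context d (T : measurableType d).

Definition centered_nontrivial (P : probability T R) (X : T -> H) : Prop :=
  [/\ strongly_measurable X, bochner_expectation P X = 0,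
      (0 < moment P p X)%E & (moment P p X < +oo)%E].

(* Both applications of [fine] are to finite expectations when
   [centered_nontrivial P X] holds, the first one because [clip tau] is
   bounded. *)
Definition clipping_ratio (P : probability T R) (X : T -> H) : R :=
  let Y := clip tau \o X in
  let b := bochner_expectation P Y in
  (alpha * `|b| + beta * tau^-1 * fine ('E_P[(fun w => `|Y w - b| ^+ 2)%R])%E)
  / (tau `^ (1 - p) * fine (moment P p X)).

End ClippingRatio.

Definition two_point d (T : measurableType d) : Prop :=
  ([set: T] #= `I_2)%card /\ forall A : set T, measurable A.

Definition clipping_ratios (R : realType) (H : completeNormedModType R)
    (p tau alpha beta : R) : set (\bar R) :=
  [set r | exists (d : measure_display) (T : measurableType d)
             (P : probability T R) (X : T -> H),
           centered_nontrivial p P X /\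
           r = (clipping_ratio p tau alpha beta P X)%:E].

Definition two_point_clipping_ratios (R : realType)
    (H : completeNormedModType R) (p tau alpha beta : R) : set (\bar R) :=
  [set r | exists (d : measure_display) (T : measurableType d)
             (P : probability T R) (X : T -> H),
           [/\ two_point T, centered_nontrivial p P X
             & r = (clipping_ratio p tau alpha beta P X)%:E]].

(* Main.v *)
Require Import Defs.
From HB Require Import structures.
From mathcomp Require Import all_boot all_order all_algebra.
From mathcomp Require Import sesquilinear finmap.
From mathcomp Require Import all_classical all_reals all_analysis measurable_realfun.
From mathcomp Require Import ring lra.

Set Implicit Arguments.
Unset Strict Implicit.
Unset Printing Implicit Defensive.

Import Order.TTheory GRing.Theory Num.Theory.
Import numFieldNormedType.Exports.

Local Open Scope classical_set_scope.
Local Open Scope ring_scope.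

(** Write Y for the clipped variable, m for the mean of X and b for that of Y.

    The upper bound reduces to one real variable. Since norm (b - m) is at
    most the mean of norm (Y - X), and the variance of Y is at most its second
    moment, the left-hand side is at most the expectation of
    alpha * norm (Y - X) + (beta / tau) * norm Y ^ 2, called [loss] below. This
    integrand depends on norm X only: with u = norm X / tau it is tau times
    alpha * max (u - 1) 0 + beta * (min u 1)^2, called [penalty].
    So it suffices that penalty u <= K * u `^ p. For u <= 1 this holds because
    p <= 2 and beta <= K. For u >= 1 it is Bernoulli's inequality: K * u `^ p
    is convex and, when alpha > p * beta, K is exactly the constant for which
    this curve is tangent to the line alpha * (u - 1) + beta; the tangency
    point r is [contact_radius], and r > 1 ([K_contact], [K_slope]).

    The bound is sharp on two-point variables along a line. If
    alpha <= p * beta, the symmetric variable with values tau and - tau gives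
    the ratio beta. Otherwise give X the value tau * r with small probability
    q and otherwise a small value of the opposite sign that makes the mean 0;
    almost all of the moment, of the bias and of the variance then comes from
    the atom at tau * r, and the ratio tends to (alpha * (r - 1) + beta) /
    r `^ p = K as q tends to 0.

    The supremum is not attained when alpha > p * beta. Equality would force
    equality in penalty u <= K * u `^ p almost surely, hence norm X is 0 or
    tau * r almost surely. On both events Y = X / r, so b = m / r = 0. But
    with b = m = 0 the term in alpha disappears, and the inequality for
    alpha = 0 has the constant beta, which is strictly less than K
    ([clipping_inequality_strict]).

    All facts about Bochner expectations are derived from one: the inner
    product of the expectation of X with h is the real integral of the inner
    product of X with h ([bochner_expectation_dot]). It holds for simple
    functions by a finite computation and passes to L^1 limits; uniqueness,
    norm bounds and the variance identity then follow by pairing with a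
    suitable h. *)

(** * Inner product *)

Section InnerProduct.
Context (R : realType) (H : completeNormedModType R).
Variables (dot : {dot H for idfun}) (dotH : hilbert_dot dot).

Lemma dotC (x y : H) : dot x y = dot y x.
Proof. by rewrite hermC expr0 mul1r. Qed.

Lemma dotxx (x : H) : dot x x = `|x| ^+ 2.
Proof.
rewrite dotH sqr_sqrtr//; have [->|x0] := eqVneq x 0; first by rewrite linear0.
by rewrite ltW// neq0_dnorm_gt0.
Qed.

Lemma dotZl (a : R) (x y : H) : dot (a *: x) y = a * dot x y.
Proof. by rewrite linearZl_LR. Qed.

Lemma dotZr (a : R) (x y : H) : dot x (a *: y) = a * dot x y.
Proof. by rewrite dotC dotZl dotC. Qed.

Lemma dotBl (x y z : H) : dot (x - y) z = dot x z - dot y z.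
Proof. by rewrite linearBl. Qed.

Lemma dotBr (x y z : H) : dot x (y - z) = dot x y - dot x z.
Proof. by rewrite dotC dotBl !(dotC x). Qed.

Lemma dot_suml (I : Type) (r : seq I) (F : I -> H) (y : H) :
  dot (\sum_(i <- r) F i) y = \sum_(i <- r) dot (F i) y.
Proof. by rewrite linear_sumlz. Qed.

Lemma normB_sqr (x y : H) : `|x - y| ^+ 2 = `|x| ^+ 2 - 2 * dot x y + `|y| ^+ 2.
Proof. by rewrite -!dotxx dotBl !dotBr (dotC y x); ring. Qed.

(** The Cauchy-Schwarz inequality: expand the squared norm of
    (dot y y) *: x - (dot x y) *: y, which is nonnegative. *)
Lemma norm_dot_le (x y : H) : `|dot x y| <= `|x| * `|y|.
Proof.
have [->|y0] := eqVneq y 0; first by rewrite linear0 !normr0 mulr0.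
have yy : 0 < `|y| ^+ 2 by rewrite exprn_gt0// normr_gt0.
rewrite -ler_sqr ?nnegrE ?mulr_ge0// exprMn (real_normK (num_real _)).
have := sqr_ge0 (`| (`|y| ^+ 2) *: x - dot x y *: y|).
rewrite normB_sqr !normrZ dotZl dotZr !exprMn !(real_normK (num_real _)) => le0.
rewrite -(ler_pM2l yy) -subr_ge0; apply: le_trans le0 _.
by rewrite le_eqVlt; apply/orP; left; apply/eqP; ring.
Qed.

(** Vectors are recovered from their inner products; identities between
    expectations are reduced to real integrals in this way. *)
Lemma dot_inj (x y : H) : (forall h, dot x h = dot y h) -> x = y.
Proof.
move=> xy; apply/eqP; rewrite -subr_eq0 -normr_eq0 -sqrf_eq0 -dotxx dotBl.
by rewrite xy subrr.
Qed.

Lemma dot_continuous (h : H) : continuous (fun x => dot x h).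
Proof.
move=> x; apply/cvgrPdist_le => e e0.
near=> y; rewrite -dotBl (le_trans (norm_dot_le _ _))//.
have h0 : 0 < `|h| + 1 by rewrite ltr_wpDl.
rewrite (@le_trans _ _ (`|x - y| * (`|h| + 1)))//.
  by rewrite ler_wpM2l// lerDl.
rewrite -ler_pdivlMr//; near: y.
apply: cvgr_dist_le; first exact: cvg_id.
by rewrite divr_gt0.
Unshelve. all: by end_near. Qed.

End InnerProduct.

(** * Strongly measurable functions *)

Section StrongMeasurability.
Context (R : realType) (H : completeNormedModType R).
Context d (T : measurableType d).
Implicit Types (s X Y : T -> H).

(** The composition takes finitely many values, each on a measurable set, so
    every preimage is a finite union of such sets. *)
Lemma measurable_simple (g : H -> R) s :
  simple_function s -> measurable_fun [set: T] (g \o s).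
Proof.
move=> [sfin ms] _ B mB; rewrite setTI.
rewrite (_ : _ @^-1` B =
    \bigcup_(h in range s `&` [set h | B (g h)]) s @^-1` [set h]).
  apply: fin_bigcup_measurable => //.
  by apply: sub_finite_set sfin => h [].
apply/seteqP; split=> [w Bw|w [h [_ Bh] /= wh]]; last by rewrite /= wh.
by exists (s w) => //; split => //; exists w.
Qed.

(** The level sets are finite unions of intersections of level sets of [s]
    and [t]. *)
Lemma simple_function_map2 (phi : H -> H -> H) s t :
  simple_function s -> simple_function t ->
  simple_function (fun w => phi (s w) (t w)).
Proof.
move=> [sfin ms] [tfin mt]; split.
  apply: sub_finite_set (finite_image2 phi sfin tfin) => _ [w _ <-].
  by exists (s w); [exists w|exists (t w); [exists w|]].
move=> h; rewrite (_ : _ @^-1` _ = \bigcup_(a in range s) \bigcup_(b in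
    range t `&` [set b | phi a b = h]) (s @^-1` [set a] `&` t @^-1` [set b])).
  apply: fin_bigcup_measurable => // a _; apply: fin_bigcup_measurable.
    by apply: sub_finite_set tfin => b [].
  by move=> b _; apply: measurableI.
apply/seteqP; split=> [w /= wh|w [a _ [b [_ abh]]]].
  by exists (s w); [exists w|exists (t w) => //; split=> //; exists w].
by move=> [/= -> ->].
Qed.

Lemma simple_function_restrict (A : set T) s : measurable A ->
  simple_function s -> simple_function (fun w => if w \in A then s w else 0).
Proof.
move=> mA [sfin ms]; split.
  have fin0 : finite_set (range s `|` [set 0]) by rewrite finite_setU.
  apply: sub_finite_set fin0 => _ [w _ <-].
  by case: ifP => _; [left; exists w|right].
move=> h; rewrite (_ : _ @^-1` _ =
    (A `&` s @^-1` [set h]) `|` (~` A `&` [set w | 0 = h])).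
  apply: measurableU; apply: measurableI => //; first exact: measurableC.
  have [h0|h0] := pselect (0 = h).
    by rewrite (_ : [set _ | _] = setT)//; apply/seteqP; split.
  by rewrite (_ : [set _ | _] = set0)//; apply/seteqP; split.
apply/seteqP; split=> w /=.
  by case: ifPn; [rewrite inE; left|rewrite notin_setE; right].
by move=> [[Aw <-]|[nAw <-]]; [rewrite mem_set|rewrite memNset].
Qed.

Lemma strongly_measurable_simple s :
  simple_function s -> strongly_measurable s.
Proof. by move=> ss; exists (fun=> s); split=> // w; exact: cvg_cst. Qed.

Lemma strongly_measurableB X Y : strongly_measurable X ->
  strongly_measurable Y -> strongly_measurable (fun w => X w - Y w).
Proof.
move=> [s [ss sX]] [t [tt tY]]; exists (fun n w => s n w - t n w); split.
  by move=> n; apply: (@simple_function_map2 (fun a b => a - b)).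
by move=> w; apply: cvgB.
Qed.

Lemma strongly_measurable_comp (phi : H -> H) X : continuous phi ->
  strongly_measurable X -> strongly_measurable (phi \o X).
Proof.
move=> cphi [s [ss sX]]; exists (fun n => phi \o s n); split.
  by move=> n; apply: (@simple_function_map2 (fun a _ => phi a) _ (s n)).
by move=> w; apply: continuous_cvg; [exact: cphi|exact: sX].
Qed.

(** Pointwise limits of measurable real functions are measurable; this gives
    the measurability of every real-valued integrand below. *)
Lemma measurable_strongly (g : H -> R) X : continuous g ->
  strongly_measurable X -> measurable_fun [set: T] (g \o X).
Proof.
move=> cg [s [ss sX]].
apply: (@measurable_fun_cvg _ _ _ _ (fun n => g \o s n)).
  by move=> n; exact: measurable_simple.
by move=> w _; apply: continuous_cvg; [exact: cg|exact: sX].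
Qed.

Lemma measurable_norm_strongly X : strongly_measurable X ->
  measurable_fun [set: T] (fun w => `|X w|).
Proof. by apply: (measurable_strongly (g := Num.norm)); exact: norm_continuous. Qed.

End StrongMeasurability.

(** * Integrals of simple functions *)

Section BochnerExpectation.
Context (R : realType) (H : completeNormedModType R).
Variables (dot : {dot H for idfun}) (dotH : hilbert_dot dot).
Context d (T : measurableType d) (P : probability T R).
Implicit Types (s X Y : T -> H).

Lemma integrable_dominated (f g : T -> R) : measurable_fun [set: T] f ->
  (forall w, `|f w| <= g w) ->
  P.-integrable [set: T] (EFin \o g) -> P.-integrable [set: T] (EFin \o f).
Proof.
move=> mf fg; apply: le_integrable => //; first exact/measurable_EFinP.
by move=> w _ /=; rewrite lee_fin (le_trans (fg w)) ?ler_norm.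
Qed.

Lemma expectation_Rintegral (f : T -> R) :
  P.-integrable [set: T] (EFin \o f) -> 'E_P[f]%E = (\int[P]_w f w)%:E.
Proof. by move=> fi; rewrite unlock /Rintegral fineK// integrable_fin_num. Qed.

Lemma integrable_norm_simple s : simple_function s ->
  P.-integrable [set: T] (EFin \o (fun w => `|s w|)).
Proof.
move=> ss; apply: measurable_bounded_integrable => //.
- by rewrite (le_lt_trans (probability_le1 P measurableT))// ltry.
- exact: (measurable_simple Num.norm ss).
have [M sM] : exists M, forall h, range s h -> `|h| <= M.
  case: ss => sfin _; exists (\sum_(h <- fset_set (range s)) `|h|) => h sh.
  have hin : h \in fset_set (range s) by rewrite in_fset_set// inE.
  by rewrite (bigD1_seq h hin (fset_uniq _))/= lerDl sumr_ge0.
exists M; split; first exact: num_real.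
move=> N MN w _ /=; rewrite normr_id (le_trans _ (ltW MN))//.
by apply: sM; exists w.
Qed.

(** Both sides are the sum over the values a of [s] of P (s = a) * dot a h. It
    makes the additivity of the expectation of simple functions a consequence
    of that of the real integral, without a common refinement of partitions. *)
Lemma dot_simple_expectation s h : simple_function s ->
  dot (simple_expectation P s) h = \int[P]_w dot (s w) h.
Proof.
move=> [sfin ms]; rewrite /simple_expectation fsbig_finite//=.
set r := fset_set _.
have msr (a : H) : measurable (s @^-1` [set a]) by exact: ms.
have indi (a : H) : P.-integrable [set: T]
    (fun w => (\1_(s @^-1` [set a]) w)%:E).
  exact: integrable_indic.
rewrite dot_suml /Rintegral.
transitivity (fine (\int[P]_w
    \sum_(a <- r) ((dot a h)%:E * (\1_(s @^-1` [set a]) w)%:E))%E).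
  rewrite integral_sum//; last by move=> a; exact: integrableZl.
  rewrite -sum_fine; last first.
    by move=> a _; rewrite integrable_fin_num//; exact: integrableZl.
  apply: eq_bigr => a _; rewrite integralZl// fineM//; last first.
    by rewrite integrable_fin_num.
  by rewrite integral_indic// setIT dotZl mulrC.
congr fine; apply: eq_integral => w _.
rewrite (bigD1_seq (s w))/=; last 2 first.
- by rewrite /r in_fset_set// inE; exists w.
- exact: fset_uniq.
rewrite indicE mem_set//= mule1 big1 ?adde0// => a aw.
by rewrite indicE memNset ?mule0//= => /esym/eqP; rewrite (negPf aw).
Qed.

Lemma integrable_dot X h : strongly_measurable X ->
  P.-integrable [set: T] (EFin \o (fun w => `|X w|)) ->
  P.-integrable [set: T] (EFin \o (fun w => dot (X w) h)).
Proof.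
move=> mX iX; apply: (@integrable_dominated _ (fun w => `|h| * `|X w|)).
- apply: (@measurable_strongly _ _ _ _ (fun x => dot x h)) => //.
  exact: dot_continuous.
- by move=> w; rewrite mulrC; exact: norm_dot_le.
- exact: (integrableZl _ `|h| iX).
Qed.

End BochnerExpectation.

(** * Existence and properties of the Bochner expectation *)

Section BochnerExistence.
Context (R : realType) (H : completeNormedModType R).
Variables (dot : {dot H for idfun}) (dotH : hilbert_dot dot).
Context d (T : measurableType d) (P : probability T R).
Implicit Types (s X Y : T -> H).
Let integrable_norm X := P.-integrable [set: T] (EFin \o (fun w => `|X w|)).

Lemma integrable_normB X Y : strongly_measurable X -> strongly_measurable Y ->
  integrable_norm X -> integrable_norm Y ->
  integrable_norm (fun w => X w - Y w).
Proof.
move=> mX mY iX iY.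
apply: (@integrable_dominated _ _ _ _ _ (fun w => `|X w| + `|Y w|)).
- exact/measurable_norm_strongly/strongly_measurableB.
- by move=> w; rewrite normr_id ler_normB.
- exact: (integrableD _ iX iY).
Qed.

Lemma Rintegral_dotB_le X Y h : strongly_measurable X -> strongly_measurable Y ->
  integrable_norm X -> integrable_norm Y ->
  `|\int[P]_w dot (X w) h - \int[P]_w dot (Y w) h|
    <= `|h| * \int[P]_w `|X w - Y w|.
Proof.
move=> mX mY iX iY; have mXY := strongly_measurableB mX mY.
have iXY := integrable_normB mX mY iX iY.
have idXY := integrable_dot dotH h mXY iXY.
rewrite -RintegralB//; try exact: integrable_dot.
under eq_Rintegral do rewrite -dotBl.
rewrite (le_trans (le_normr_Rintegral _ idXY))// -RintegralZl//.
apply: le_Rintegral => //.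
- exact: (integrable_abse idXY).
- exact: (integrableZl _ `|h| iXY).
- by move=> w _; rewrite mulrC; exact: norm_dot_le.
Qed.

(** Pair [v] with itself: norm v ^ 2 <= norm v * (integral of norm (X - Y)). *)
Lemma norm_le_Rintegral_dual (v : H) X Y :
  strongly_measurable X -> strongly_measurable Y ->
  integrable_norm X -> integrable_norm Y ->
  (forall h, dot v h = \int[P]_w dot (X w) h - \int[P]_w dot (Y w) h) ->
  `|v| <= \int[P]_w `|X w - Y w|.
Proof.
move=> mX mY iX iY vXY.
have [->|v0] := eqVneq v 0; first by rewrite normr0 Rintegral_ge0.
have := Rintegral_dotB_le v mX mY iX iY.
by rewrite -vXY dotxx// normrX normr_id expr2 ler_pM2l// normr_gt0.
Qed.

(** Transfers the L^1 convergence in the definition of the Bochner expectation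
    from the extended reals, where the hypotheses live, to the reals. *)
Lemma expectation_normB_cvg X (s : nat -> T -> H) :
  strongly_measurable X -> (forall n, simple_function (s n)) ->
  integrable_norm X ->
  ('E_P[(fun w => `|X w - s n w|)%R])%E @[n --> \oo] --> 0%E <->
  (\int[P]_w `|X w - s n w|) @[n --> \oo] --> (0 : R).
Proof.
move=> mX ss iX.
rewrite (_ : (fun n => _ : \bar R) =
    EFin \o (fun n => \int[P]_w `|X w - s n w|)).
  by split => [/fine_cvg//|cv]; apply: cvg_EFin => //; exact: nearW.
apply/funext => n; rewrite expectation_Rintegral//.
apply: integrable_normB => //; first exact: strongly_measurable_simple.
exact: integrable_norm_simple.
Qed.

(** True for simple functions, and both sides are continuous along L^1
    convergence; in particular the Bochner expectation is unique. *)
Lemma is_bochner_expectation_dot X m h : integrable_norm X ->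
  is_bochner_expectation P X m -> dot m h = \int[P]_w dot (X w) h.
Proof.
move=> iX [mX [s [ss /(expectation_normB_cvg mX ss iX) sX sm]]].
have msn n := strongly_measurable_simple (ss n).
have isn n : integrable_norm (s n) := integrable_norm_simple P (ss n).
apply: (@cvg_unique _ _ (dot (simple_expectation P (s n)) h @[n --> \oo])).
- exact: norm_hausdorff.
- exact: (cvg_comp _ _ sm (@dot_continuous _ _ _ dotH h m)).
apply/cvgrPdist_le => e e0.
have hX : (`|h| * \int[P]_w `|X w - s n w|) @[n --> \oo] --> (0 : R).
  by rewrite -(mulr0 `|h|); apply: cvgMr.
near=> n; rewrite dot_simple_expectation//.
rewrite (le_trans (Rintegral_dotB_le _ mX (msn n) iX (isn n)))//.
by rewrite (le_trans (ler_norm _))//; near: n; exact: cvgr0_norm_le.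
Unshelve. all: by end_near. Qed.

(** Pointwise approximations need not converge in L^1. Replacing s_n by 0 where
    norm s_n > 2 * norm X keeps the pointwise convergence and gives the
    integrable bound 3 * norm X, so dominated convergence applies. *)
Lemma simple_approximation X : strongly_measurable X -> integrable_norm X ->
  exists s : nat -> T -> H, (forall n, simple_function (s n)) /\
    (\int[P]_w `|X w - s n w|) @[n --> \oo] --> (0 : R).
Proof.
move=> mX iX; have [s [ss sX]] := mX.
(* Where X vanishes the truncation is 0; elsewhere it is eventually inactive. *)
pose A n := [set w | `|s n w| <= 2 * `|X w|].
have mA n : measurable (A n).
  rewrite (_ : A n = (fun w => 2 * `|X w| - `|s n w|) @^-1` `[0, +oo[).
    rewrite -[X in measurable X]setTI; apply: measurable_funB => //.
      by apply: measurable_funM => //; exact: measurable_norm_strongly.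
    exact: (measurable_simple Num.norm (ss n)).
  by apply/seteqP; split => w /=; rewrite in_itv/= andbT subr_ge0.
pose t n w := if w \in A n then s n w else 0.
have st n : simple_function (t n) by exact: simple_function_restrict.
have mt n := strongly_measurable_simple (st n).
have t2X n w : `|t n w| <= 2 * `|X w|.
  by rewrite /t; case: ifPn; [rewrite inE|rewrite normr0 mulr_ge0].
have tX w : t n w @[n --> \oo] --> X w.
  have [X0|X0] := eqVneq (X w) 0.
    rewrite (_ : (fun n => t n w) = fun=> X w); first exact: cvg_cst.
    apply/funext => n; rewrite X0; apply/eqP; rewrite -normr_eq0 eq_le normr_ge0.
    by rewrite (le_trans (t2X n w))// X0 normr0 mulr0.
  apply: cvg_trans (sX w); apply: near_eq_cvg; near=> n.
  rewrite /t mem_set//= /A/= ltW//; near: n.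
  apply: (cvgr_lt `|X w|); first exact: cvg_norm.
  by rewrite -[ltLHS]mul1r ltr_pM2r ?normr_gt0// ltr1n.
exists t; split=> //; apply/expectation_normB_cvg => //.
rewrite unlock.
have -> : 0%E = (\int[P]_w (cst 0%E w : \bar R))%E by rewrite integral0.
have [] // := @dominated_convergence _ _ _ P _ measurableT
  (fun n w => (`|X w - t n w|)%:E) (cst 0%E) (fun w => (3%:E * (`|X w|)%:E)%E).
- move=> n; apply/measurable_EFinP.
  exact/measurable_norm_strongly/strongly_measurableB.
- apply: aeW => w _; apply: cvg_EFin; first exact: nearW.
  rewrite -(normr0 H) -(subrr (X w)); apply: cvg_norm; apply: cvgB => //.
  exact: cvg_cst.
- exact: integrableZl.
- apply: aeW => w n _; rewrite abse_EFin normr_id -EFinM lee_fin.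
  rewrite (le_trans (ler_normB _ _))//.
  by have := t2X n w; lra.
Unshelve. all: by end_near. Qed.

(** The expectations of L^1-approximating simple functions form a Cauchy
    sequence, and [H] is complete. *)
Lemma is_bochner_expectation_ex X : strongly_measurable X ->
  integrable_norm X -> exists m, is_bochner_expectation P X m.
Proof.
move=> mX iX; have [s [ss sX]] := simple_approximation mX iX.
have msn n := strongly_measurable_simple (ss n).
have isn n : integrable_norm (s n) := integrable_norm_simple P (ss n).
suff /cvg_ex[m sm] : cvg (simple_expectation P (s n) @[n --> \oo]).
  by exists m; split => //; exists s; split=> //; apply/expectation_normB_cvg.
apply: cauchy_cvg; apply: cauchy_exP => e e0.
have : \forall n \near \oo, \int[P]_w `|X w - s n w| < e / 2.
  by apply: (cvgr_lt 0) => //; rewrite divr_gt0.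
move=> [N _ Ns]; exists (simple_expectation P (s N)).
exists N => // n Nn; rewrite /= -ball_normE /=.
apply: (@le_lt_trans _ _ (\int[P]_w `|s N w - s n w|)).
  apply: norm_le_Rintegral_dual => // h.
  by rewrite dotBl !dot_simple_expectation.
have iXs k : integrable_norm (fun w => X w - s k w) by exact: integrable_normB.
apply: (@le_lt_trans _ _ (\int[P]_w (`|X w - s N w| + `|X w - s n w|))).
  apply: le_Rintegral => //; first exact: integrable_normB.
    exact: (integrableD _ (iXs N) (iXs n)).
  by move=> w _; rewrite (distrC (X w)) ler_distD.
rewrite RintegralD//; [|exact: iXs..]; have := Ns _ Nn; have := Ns _ (leqnn N).
by move: (\int[P]_w _) (\int[P]_w _) => a b; lra.
Qed.

Lemma bochner_expectation_dot X h : strongly_measurable X ->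
  integrable_norm X ->
  dot (bochner_expectation P X) h = \int[P]_w dot (X w) h.
Proof.
move=> mX iX; apply: is_bochner_expectation_dot => //.
exact/(@xgetPex _ _ [set m | is_bochner_expectation P X m])/is_bochner_expectation_ex.
Qed.

Lemma norm_bochner_expectationB_le X Y :
  strongly_measurable X -> strongly_measurable Y ->
  integrable_norm X -> integrable_norm Y ->
  `|bochner_expectation P X - bochner_expectation P Y|
    <= \int[P]_w `|X w - Y w|.
Proof.
move=> mX mY iX iY; apply: norm_le_Rintegral_dual => // h.
by rewrite dotBl !bochner_expectation_dot.
Qed.

(** Expand the square; the cross term integrates to norm b ^ 2 by
    [bochner_expectation_dot]. *)
Lemma bochner_variance Y : strongly_measurable Y -> integrable_norm Y ->
  P.-integrable [set: T] (EFin \o (fun w => `|Y w| ^+ 2)) ->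
  let b := bochner_expectation P Y in
  P.-integrable [set: T] (EFin \o (fun w => `|Y w - b| ^+ 2)) /\
  \int[P]_w (`|Y w - b| ^+ 2) = \int[P]_w (`|Y w| ^+ 2) - `|b| ^+ 2.
Proof.
move=> mY iY iY2 b.
have idot : P.-integrable [set: T] (EFin \o (fun w => 2 * dot (Y w) b)).
  exact: (integrableZl _ 2 (integrable_dot dotH b mY iY)).
have icst : P.-integrable [set: T] (EFin \o (fun=> `|b| ^+ 2)).
  exact: finite_measure_integrable_cst.
have i1 : P.-integrable [set: T] (EFin \o (fun w => `|Y w| ^+ 2 - 2 * dot (Y w) b)).
  exact: (integrableB _ iY2 idot).
have normE : (fun w => `|Y w - b| ^+ 2) =
    (fun w => `|Y w| ^+ 2 - 2 * dot (Y w) b + `|b| ^+ 2).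
  by apply/funext => w; rewrite (normB_sqr dotH).
rewrite normE; split; first exact: (integrableD _ i1 icst).
rewrite RintegralD// RintegralB// RintegralZl//; last exact: integrable_dot.
rewrite -bochner_expectation_dot// dotxx//.
have -> : \int[P]_w (`|b| ^+ 2) = `|b| ^+ 2.
  have := expectation_cst P (`|b| ^+ 2); rewrite unlock => bE.
  exact: (congr1 fine bE).
by ring.
Qed.

End BochnerExistence.

(** * Radial clipping and the sharp constant *)

Section Clip.
Context (R : realType) (H : completeNormedModType R).
Variables (tau : R) (tau_gt0 : 0 < tau).

(** A formula without case distinction, from which continuity is immediate. *)
Lemma clipE (x : H) : clip tau x = (tau / Num.max tau `|x|) *: x.
Proof.
rewrite /clip; case: leP => xt; last by [].
by rewrite divff ?scale1r// gt_eqF.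
Qed.

Lemma clip_continuous : continuous (clip tau : H -> H).
Proof.
move=> x; rewrite (_ : clip tau = fun x => (tau / Num.max tau `|x|) *: x); last first.
  by apply/funext => y; exact: clipE.
apply: cvgZ; last exact: cvg_id.
apply: cvgM; first exact: cvg_cst.
apply: cvgV; first by rewrite gt_eqF// lt_max tau_gt0.
apply: continuous_max; first exact: cvg_cst.
exact: norm_continuous.
Qed.

Lemma norm_clip (x : H) : `|clip tau x| = Num.min `|x| tau.
Proof.
rewrite /clip; case: leP => // xt; rewrite normrZ.
have x0 := lt_trans tau_gt0 xt.
by rewrite ger0_norm ?divfK ?gt_eqF// divr_ge0// ltW.
Qed.

Lemma norm_clipB (x : H) : `|clip tau x - x| = Num.max (`|x| - tau) 0.
Proof.
rewrite /clip; case: leP => xt.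
  by rewrite subrr normr0; apply/esym/max_idPr; rewrite subr_le0.
have x0 := lt_trans tau_gt0 xt.
rewrite (_ : _ - x = (tau / `|x| - 1) *: x); last by rewrite scalerBl scale1r.
rewrite normrZ ler0_norm; last by rewrite subr_le0 ler_pdivrMr// mul1r ltW.
rewrite opprB mulrBl mul1r divfK ?gt_eqF//.
by apply/esym/max_idPl; rewrite subr_ge0 ltW.
Qed.

End Clip.

Section SharpConstant.
Context (R : realType).
Variables (p : R) (p_gt1 : 1 < p) (p_le2 : p <= 2).

Let p_gt0 : 0 < p. Proof. exact: lt_trans p_gt1. Qed.

Lemma powRV (x y : R) : 0 <= x -> x^-1 `^ y = (x `^ y)^-1.
Proof. by move=> x0; rewrite -powR_inv1// -powRrM mulN1r powRN. Qed.

(** Bernoulli's inequality for real exponents, as Young's inequality for t and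
    1 with the conjugate exponents p and p / (p - 1). *)
Lemma bernoulli_powR (t : R) : 0 <= t -> 1 + p * (t - 1) <= t `^ p.
Proof.
move=> t0; have q0 : 0 < p / (p - 1) by rewrite divr_gt0// subr_gt0.
have := conjugate_powR t0 (@ler01 R) p_gt0 q0.
rewrite powR1 mulr1 invf_div => young.
have {young} : t <= t `^ p / p + 1 * ((p - 1) / p).
  apply: young; field.
  by rewrite !gt_eqF// subr_gt0.
rewrite -(ler_pM2l p_gt0) mul1r mulrDr mulrCA divff ?gt_eqF// mulr1.
by rewrite mulrCA divff ?gt_eqF// mulr1; lra.
Qed.

(** Strictness comes from squaring: the inequality at s, the square root of t,
    gives t `^ p >= (1 + p * (s - 1)) ^ 2, which exceeds 1 + p * (s ^ 2 - 1) by
    p * (p - 1) * (s - 1) ^ 2. When 1 + p * (s - 1) < 0, the tangent line is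
    negative at t as well. *)
Lemma bernoulli_powR_lt (t : R) : 0 < t -> t != 1 -> 1 + p * (t - 1) < t `^ p.
Proof.
move=> t0 t1; have [neg|pos] := ltP (1 + p * (t - 1)) 0.
  by rewrite (lt_trans neg)// powR_gt0.
pose s := Num.sqrt t; have s0 : 0 < s by rewrite sqrtr_gt0.
have ts : t = s ^+ 2 by rewrite sqr_sqrtr// ltW.
have := bernoulli_powR (ltW s0).
have tsp : t `^ p = (s `^ p) ^+ 2 by rewrite ts expr2 powRM ?ltW// -expr2.
(* If 1 + p * (s - 1) < 0 then s < 1, so t = s ^ 2 < s. *)
have [sneg|spos] := ltP (1 + p * (s - 1)) 0.
  have s1 : s < 1.
    rewrite ltNge; apply/negP => s1; move: sneg; rewrite ltNge addr_ge0//.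
    by rewrite mulr_ge0 ?subr_ge0// ltW.
  suff : 1 + p * (t - 1) < 0 by rewrite ltNge pos.
  apply: le_lt_trans sneg; rewrite lerD2l ler_pM2l// lerD2r ts expr2.
  by rewrite -[leRHS]mulr1 ler_pM2l// ltW.
move=> /(@lerXn2r _ 2%N) le2; apply: (@lt_le_trans _ _ ((1 + p * (s - 1)) ^+ 2)).
  have s1 : 0 < (s - 1) ^+ 2.
    rewrite exprn_even_gt0//= subr_eq0; apply: contra t1 => /eqP s1.
    by rewrite ts s1 expr1n.
  rewrite ts -subr_gt0.
  rewrite (_ : _ - _ = p * (p - 1) * (s - 1) ^+ 2); last by ring.
  by rewrite pmulr_lgt0// pmulr_lgt0// subr_gt0.
by rewrite tsp le2 ?nnegrE ?powR_ge0.
Qed.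

Variables (alpha beta : R) (alpha_ge0 : 0 <= alpha) (beta_ge0 : 0 <= beta).
Let K := K_ p alpha beta.

(** For alpha > p * beta, the point where the line alpha * (u - 1) + beta
    touches K * u `^ p, that is, the maximiser of (alpha * (u - 1) + beta) / u `^ p. *)
Definition contact_radius := p * (alpha - beta) / ((p - 1) * alpha).
Let r := contact_radius.

(** The bias and variance cost of an outcome of norm u for the threshold 1. *)
Definition penalty (u : R) := alpha * Num.max (u - 1) 0 + beta * Num.min u 1 ^+ 2.

Lemma penalty_le1 u : u <= 1 -> penalty u = beta * u ^+ 2.
Proof.
by move=> u1; rewrite /penalty (max_idPr _) ?subr_le0// (min_idPl _)// mulr0 add0r.
Qed.

Lemma penalty_ge1 u : 1 <= u -> penalty u = alpha * (u - 1) + beta.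
Proof.
move=> u1; rewrite /penalty (max_idPl _) ?subr_ge0// (min_idPr _)//.
by rewrite expr1n mulr1.
Qed.

Lemma le_sqr_powR u : 0 <= u <= 1 -> u ^+ 2 <= u `^ p.
Proof.
move=> /andP[]; rewrite le_eqVlt => /predU1P[<- _|u0 u1].
  by rewrite powR0 ?gt_eqF// expr0n.
have u01 : 0 < u <= 1 by rewrite u0.
by have := ger_powR u01 p_le2; rewrite powR_mulrn// ltW.
Qed.

Section Supercritical.
Hypothesis ab : p * beta < alpha.

Let beta_lt_alpha : beta < alpha.
Proof. by apply: le_lt_trans ab; rewrite -[leLHS]mul1r ler_wpM2r// ltW. Qed.
Let alpha_gt0 : 0 < alpha. Proof. exact: le_lt_trans beta_lt_alpha. Qed.
Let p1_gt0 : 0 < p - 1. Proof. by rewrite subr_gt0. Qed.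

Lemma contact_radius_gt1 : 1 < r.
Proof.
rewrite /r /contact_radius ltr_pdivlMr ?mulr_gt0// mul1r.
by move: ab; lra.
Qed.

Let r_gt0 : 0 < r. Proof. exact: lt_trans contact_radius_gt1. Qed.

(** The curve K * u `^ p and the line alpha * (u - 1) + beta meet at
    [contact_radius]; the common value there is (alpha - beta) / (p - 1). *)
Lemma K_contact : K * r `^ p = alpha * (r - 1) + beta.
Proof.
have u0 : 0 < alpha - beta by rewrite subr_gt0.
have -> : alpha * (r - 1) + beta = (alpha - beta) / (p - 1).
  by rewrite /r /contact_radius; field; rewrite !gt_eqF.
have rp : r `^ p = (p `^ p * ((alpha - beta) * (alpha - beta) `^ (p - 1)))
    / ((p - 1) * (p - 1) `^ (p - 1) * alpha `^ p).
  rewrite /r /contact_radius powRM ?mulr_ge0 ?invr_ge0 ?mulr_ge0 ?ltW//.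
  rewrite powRV ?mulr_ge0 ?ltW// !powRM ?ltW//.
  by rewrite !mulr_powRB1 ?ltW.
rewrite rp /K /K_ leNgt ab/= /c_.
by field; rewrite !gt_eqF ?powR_gt0.
Qed.

(** They have the same slope at that point. *)
Lemma K_slope : K * r `^ p * p = alpha * r.
Proof.
rewrite K_contact /r /contact_radius; field; rewrite !gt_eqF//.
Qed.

(** The line is tangent to a strictly convex curve: this is Bernoulli's
    inequality at u / r, multiplied by K * r `^ p. *)
Lemma affine_lt u : 0 < u -> u != r -> alpha * (u - 1) + beta < K * u `^ p.
Proof.
move=> u0 ur; have t0 : 0 < u / r by rewrite divr_gt0.
have K0 : 0 < K * r `^ p.
  rewrite K_contact ltr_wpDr// mulr_gt0// subr_gt0; exact: contact_radius_gt1.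
have uE : u `^ p = r `^ p * (u / r) `^ p.
  by rewrite -powRM ?ltW// mulrCA divff ?mulr1// gt_eqF.
rewrite uE mulrA.
apply: (@le_lt_trans _ _ (K * r `^ p * (1 + p * (u / r - 1)))); last first.
  rewrite ltr_pM2l// bernoulli_powR_lt//; apply: contra ur => /eqP ur.
  by rewrite -[u](divfK (lt0r_neq0 r_gt0)) ur mul1r.
have -> : K * r `^ p * (1 + p * (u / r - 1)) =
  K * r `^ p + K * r `^ p * p * (u / r - 1) by ring.
rewrite K_slope K_contact le_eqVlt; apply/orP; left.
by apply/eqP; field; rewrite gt_eqF.
Qed.

(** The value at u = 1, which differs from the point of tangency. *)
Lemma beta_lt_K : beta < K.
Proof.
have := @affine_lt 1 ltr01; rewrite powR1/= mulr1 subrr mulr0 add0r; apply.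
by rewrite lt_eqF// contact_radius_gt1.
Qed.

Lemma penalty_lt u : 0 < u -> u != r -> penalty u < K * u `^ p.
Proof.
move=> u0 ur; have [u1|/ltW u1] := leP u 1; last by rewrite penalty_ge1// affine_lt.
rewrite penalty_le1//.
apply: (@le_lt_trans _ _ (beta * u `^ p)).
  by rewrite ler_wpM2l// le_sqr_powR// (ltW u0).
by rewrite ltr_pM2r ?powR_gt0// beta_lt_K.
Qed.

Lemma penalty_contact : penalty r = K * r `^ p.
Proof. by rewrite K_contact penalty_ge1// ltW// contact_radius_gt1. Qed.

End Supercritical.

Lemma penalty_le u : 0 <= u -> penalty u <= K * u `^ p.
Proof.
rewrite le_eqVlt => /predU1P[<-|u0].
  by rewrite penalty_le1// expr0n mulr0 powR0 ?gt_eqF// mulr0.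
have [ab|ab] := leP alpha (p * beta); last first.
  have [->|ur] := eqVneq u r; first by rewrite penalty_contact.
  by rewrite ltW// penalty_lt.
rewrite /K /K_ ab; have [u1|/ltW u1] := leP u 1.
  by rewrite penalty_le1// ler_wpM2l// le_sqr_powR// (ltW u0).
rewrite penalty_ge1//.
apply: (@le_trans _ _ (beta * (1 + p * (u - 1)))).
  have -> : beta * (1 + p * (u - 1)) = p * beta * (u - 1) + beta by ring.
  by rewrite lerD2r ler_wpM2r// subr_ge0.
by rewrite ler_wpM2l// bernoulli_powR// ltW.
Qed.

End SharpConstant.

(** * The clipping inequality *)

Section ClippingInequality.
Context (R : realType) (H : completeNormedModType R).
Variables (dot : {dot H for idfun}) (dotH : hilbert_dot dot).
Variables (p tau : R) (p_gt1 : 1 < p) (p_le2 : p <= 2) (tau_gt0 : 0 < tau).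

(** The integrand that bounds the bias and the variance together. *)
Definition loss (alpha beta : R) (x : H) :=
  alpha * `|clip tau x - x| + beta / tau * `|clip tau x| ^+ 2.

Let p_gt0 : 0 < p. Proof. exact: lt_trans p_gt1. Qed.

Lemma loss_penalty alpha beta x :
  loss alpha beta x = tau * penalty alpha beta (`|x| / tau).
Proof.
rewrite /loss norm_clipB// norm_clip// /penalty.
have -> : Num.max (`|x| / tau - 1) 0 = Num.max (`|x| - tau) 0 / tau.
  by rewrite maxr_pMl ?invr_ge0 ?ltW// mul0r mulrBl divff ?gt_eqF.
have -> : Num.min (`|x| / tau) 1 = Num.min `|x| tau / tau.
  by rewrite minr_pMl ?invr_ge0 ?ltW// divff ?gt_eqF.
by field; rewrite gt_eqF.
Qed.

Lemma scaled_powR (x : H) :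
  tau `^ (1 - p) * `|x| `^ p = tau * (`|x| / tau) `^ p.
Proof.
have t0 := ltW tau_gt0; rewrite powRM ?invr_ge0// powRV//.
rewrite powRB; last by rewrite (gt_eqF tau_gt0) implybT.
rewrite powRr1//; by field; rewrite gt_eqF// powR_gt0.
Qed.

Section Random.
Context d (T : measurableType d) (P : probability T R) (X : T -> H).
Hypothesis LpX : in_bochner_Lp P p X.

Let mX : strongly_measurable X. Proof. by case: LpX. Qed.
Let Y := clip tau \o X.
Let m := bochner_expectation P X.
Let b := bochner_expectation P Y.

Lemma integrable_powR_norm :
  P.-integrable [set: T] (EFin \o (fun w => `|X w| `^ p)).
Proof.
case: LpX => _; rewrite /moment unlock => pX.
have mXp : measurable_fun [set: T] (fun w => `|X w| `^ p).
  exact: (measurableT_comp (measurable_powR p) (measurable_norm_strongly mX)).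
apply/integrableP; split; first exact/measurable_EFinP.
apply: le_lt_trans pX; rewrite le_eqVlt; apply/orP; left; apply/eqP.
by apply: eq_integral => w _ /=; rewrite ger0_norm ?powR_ge0.
Qed.

Lemma moment_Rintegral : moment P p X = (\int[P]_w `|X w| `^ p)%:E.
Proof. by rewrite /moment expectation_Rintegral//; exact: integrable_powR_norm. Qed.

Lemma integrable_norm_Lp :
  P.-integrable [set: T] (EFin \o (fun w => `|X w|)).
Proof.
apply: (@integrable_dominated _ _ _ _ _ (fun w => 1 + `|X w| `^ p)).
- exact: measurable_norm_strongly.
- move=> w; rewrite normr_id; have [x1|/ltW x1] := leP `|X w| 1.
    by rewrite (le_trans x1)// lerDl powR_ge0.
  by rewrite (le_trans (le1r_powR x1 (ltW p_gt1)))// lerDr.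
- have i1 : P.-integrable [set: T] (EFin \o (fun=> 1)).
    exact: finite_measure_integrable_cst.
  exact: (integrableD _ i1 integrable_powR_norm).
Qed.

Lemma strongly_measurable_clip : strongly_measurable Y.
Proof. by apply: strongly_measurable_comp => //; exact: clip_continuous. Qed.

Let mY := strongly_measurable_clip.

Lemma integrable_norm_clip :
  P.-integrable [set: T] (EFin \o (fun w => `|Y w|)).
Proof.
apply: (@integrable_dominated _ _ _ _ _ (fun w => `|X w|)).
- exact: measurable_norm_strongly.
- by move=> w; rewrite normr_id norm_clip// ge_min lexx.
- exact: integrable_norm_Lp.
Qed.

Lemma integrable_sqr_norm_clip :
  P.-integrable [set: T] (EFin \o (fun w => `|Y w| ^+ 2)).
Proof.
apply: (@integrable_dominated _ _ _ _ _ (fun=> tau ^+ 2)).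
- by apply: measurable_funX; exact: measurable_norm_strongly.
- move=> w; rewrite ger0_norm ?exprn_ge0// lerXn2r ?nnegrE ?(ltW tau_gt0)//.
  by rewrite norm_clip// ge_min lexx orbT.
- exact: finite_measure_integrable_cst.
Qed.

Lemma variance_clip_integrable :
  P.-integrable [set: T] (EFin \o (fun w => `|Y w - b| ^+ 2)).
Proof.
by case: (bochner_variance dotH mY integrable_norm_clip integrable_sqr_norm_clip).
Qed.

Variables (alpha beta : R) (alpha_ge0 : 0 <= alpha) (beta_ge0 : 0 <= beta).
Let K := K_ p alpha beta.

Lemma integrable_loss :
  P.-integrable [set: T] (EFin \o (fun w => loss alpha beta (X w))).
Proof.
have iYX : P.-integrable [set: T] (EFin \o (fun w => `|Y w - X w|)).
  apply: integrable_normB => //; first exact: integrable_norm_clip.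
  exact: integrable_norm_Lp.
have iY2 := integrable_sqr_norm_clip.
exact: (integrableD _ (integrableZl _ alpha iYX) (integrableZl _ (beta / tau) iY2)).
Qed.

(** The bias is at most the mean of norm (Y - X), and the variance at most the
    second moment of Y. *)
Lemma objective_le_loss :
  alpha * `|b - m| + beta / tau * \int[P]_w (`|Y w - b| ^+ 2)
    <= \int[P]_w loss alpha beta (X w).
Proof.
have iY := integrable_norm_clip; have iX := integrable_norm_Lp.
have iY2 := integrable_sqr_norm_clip.
have iYX : P.-integrable [set: T] (EFin \o (fun w => `|Y w - X w|)).
  exact: integrable_normB.
rewrite RintegralD//; last 2 first.
- exact: (integrableZl _ alpha iYX).
- exact: (integrableZl _ (beta / tau) iY2).
rewrite RintegralZl// RintegralZl//; apply: lerD.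
  by rewrite ler_wpM2l//; exact: (norm_bochner_expectationB_le dotH).
rewrite ler_wpM2l ?divr_ge0 ?(ltW tau_gt0)//.
have [_ ->] := bochner_variance dotH mY iY iY2.
by rewrite gerBl exprn_ge0.
Qed.

Lemma loss_le x : loss alpha beta x <= K * tau `^ (1 - p) * `|x| `^ p.
Proof.
rewrite loss_penalty -mulrA scaled_powR mulrCA ler_pM2l//.
by rewrite penalty_le// divr_ge0// ltW.
Qed.

Lemma integrable_bound : P.-integrable [set: T]
  (EFin \o (fun w => K * tau `^ (1 - p) * `|X w| `^ p)).
Proof. exact: (integrableZl _ (K * tau `^ (1 - p)) integrable_powR_norm). Qed.

Lemma Rintegral_loss_le : \int[P]_w loss alpha beta (X w)
  <= K * tau `^ (1 - p) * \int[P]_w `|X w| `^ p.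
Proof.
rewrite -RintegralZl//; last exact: integrable_powR_norm.
apply: le_Rintegral => //; first exact: integrable_loss.
  exact: integrable_bound.
by move=> w _; exact: loss_le.
Qed.

Lemma clipping_inequality :
  alpha * `|b - m| + beta / tau * \int[P]_w (`|Y w - b| ^+ 2)
    <= K * tau `^ (1 - p) * \int[P]_w `|X w| `^ p.
Proof. exact: le_trans objective_le_loss Rintegral_loss_le. Qed.

(** Equality forces norm x to be 0 or tau * r, and clipping divides by r in
    both cases. *)
Lemma clip_scale_of_loss_eq x : p * beta < alpha ->
  loss alpha beta x = K * tau `^ (1 - p) * `|x| `^ p ->
  clip tau x = (contact_radius p alpha beta)^-1 *: x.
Proof.
move=> ab; have r1 := contact_radius_gt1 p_gt1 beta_ge0 ab.
have r0 := lt_trans ltr01 r1.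
have [->|x0] := eqVneq x 0; first by rewrite /clip normr0 ltW// scaler0.
rewrite loss_penalty -mulrA scaled_powR mulrCA => /(mulfI (lt0r_neq0 tau_gt0)) E.
have xr : `|x| = contact_radius p alpha beta * tau.
  have u0 : 0 < `|x| / tau by rewrite divr_gt0// normr_gt0.
  have [<-|ur] := eqVneq (`|x| / tau) (contact_radius p alpha beta).
    by rewrite divfK// gt_eqF.
  by have := penalty_lt p_gt1 p_le2 beta_ge0 ab u0 ur; rewrite E ltxx.
rewrite /clip xr leNgt -[ltLHS]mul1r ltr_pM2r// r1/=.
by congr (_ *: _); field; rewrite !gt_eqF.
Qed.

End Random.

End ClippingInequality.

(** * Strictness of the inequality *)

Section Strictness.
Context (R : realType) (H : completeNormedModType R).
Variables (dot : {dot H for idfun}) (dotH : hilbert_dot dot).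
Variables (p tau : R) (p_gt1 : 1 < p) (p_le2 : p <= 2) (tau_gt0 : 0 < tau).
Context d (T : measurableType d) (P : probability T R) (X : T -> H).
Hypothesis LpX : in_bochner_Lp P p X.
Let Y := clip tau \o X.
Let m := bochner_expectation P X.
Let b := bochner_expectation P Y.
Variables (alpha beta : R) (alpha_ge0 : 0 <= alpha) (beta_ge0 : 0 <= beta).
Hypothesis ab : p * beta < alpha.

Let K := K_ p alpha beta.
Let bound w := K * tau `^ (1 - p) * `|X w| `^ p.

Let mX : strongly_measurable X. Proof. by case: LpX. Qed.
Let mY : strongly_measurable Y. Proof. exact: strongly_measurable_clip LpX. Qed.

(** A nonnegative function with integral 0 vanishes almost everywhere. *)
Lemma ae_loss_eq :
  \int[P]_w loss tau alpha beta (X w) = \int[P]_w bound w ->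
  {ae P, forall w, loss tau alpha beta (X w) = bound w}.
Proof.
have il := integrable_loss p_gt1 tau_gt0 LpX alpha beta.
have ib := integrable_bound tau LpX alpha beta.
move=> E; have iD : P.-integrable [set: T]
    (EFin \o (fun w => bound w - loss tau alpha beta (X w))).
  exact: (integrableB _ ib il).
have D0 w : 0 <= bound w - loss tau alpha beta (X w).
  by rewrite subr_ge0; exact: loss_le.
have : (\int[P]_w `|(bound w - loss tau alpha beta (X w))%:E| = 0)%E.
  under eq_integral do rewrite abse_EFin ger0_norm//.
  rewrite -[LHS]fineK ?integrable_fin_num//.
  by rewrite -/(Rintegral _ _ _) RintegralB// E subrr.
move=> /(ae_eq_integral_abs _ measurableT (measurable_int _ iD)).
apply: filterS => w /= /(_ I) [] /eqP; rewrite subr_eq0 => /eqP.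
by [].
Qed.

(** Equality would make Y = X / r almost surely, hence b = 0; then only the
    variance remains, and the case alpha = 0 bounds it with the smaller
    constant beta. *)
Lemma clipping_inequality_strict : m = 0 -> 0 < \int[P]_w `|X w| `^ p ->
  alpha * `|b - m| + beta / tau * \int[P]_w (`|Y w - b| ^+ 2)
    < K * tau `^ (1 - p) * \int[P]_w `|X w| `^ p.
Proof.
move=> m0 M0; rewrite lt_neqAle (clipping_inequality dotH)// andbT; apply/negP => /eqP E.
have iY := integrable_norm_clip p_gt1 tau_gt0 LpX.
have iX := integrable_norm_Lp p_gt1 LpX.
have iXp := integrable_powR_norm LpX.
have r0 : 0 < contact_radius p alpha beta.
  by rewrite (lt_trans ltr01)// contact_radius_gt1.
have b0 : b = 0.
  have : {ae P, forall w, loss tau alpha beta (X w) = bound w}.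
    have le1 := objective_le_loss dotH p_gt1 tau_gt0 LpX alpha_ge0 beta_ge0.
    have le2 := Rintegral_loss_le p_gt1 p_le2 tau_gt0 LpX alpha beta_ge0.
    apply: ae_loss_eq; rewrite [RHS]RintegralZl//.
    by apply/eqP; rewrite eq_le le2/= -E.
  move=> ae_eq; apply: (dot_inj dotH) => h.
  rewrite (bochner_expectation_dot dotH)//.
  transitivity (\int[P]_w ((contact_radius p alpha beta)^-1 * dot (X w) h)).
    congr fine; apply: ae_eq_integral => //.
    + exact: measurable_int (integrable_dot dotH h mY iY).
    + exact: measurable_int (integrableZl _ _ (integrable_dot dotH h mX iX)).
    apply: filterS ae_eq => w lw _; congr EFin.
    by rewrite -dotZl -(clip_scale_of_loss_eq p_gt1 p_le2 tau_gt0 beta_ge0 ab lw).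
  rewrite RintegralZl//; last exact: integrable_dot.
  by rewrite -(bochner_expectation_dot dotH)// -/m m0 -dotZl scaler0.
have := clipping_inequality dotH p_gt1 p_le2 tau_gt0 LpX (lexx 0) beta_ge0.
rewrite -/Y -/m -/b mul0r add0r; apply/negP; rewrite -ltNge.
move: E; rewrite m0 b0 subrr normr0 mulr0 add0r => ->.
have -> : K_ p 0 beta = beta by rewrite /K_ mulr_ge0// ltW// (lt_trans ltr01).
by rewrite -!mulrA ltr_pM2r ?mulr_gt0 ?powR_gt0//; exact: beta_lt_K.
Qed.

End Strictness.

(** * Two-point variables *)

Section TwoPoint.
Context (R : realType) (H : completeNormedModType R).
Variables (dot : {dot H for idfun}) (dotH : hilbert_dot dot).

Lemma two_point_bool : two_point bool.
Proof.
split=> //; apply/card_set_bijP; exists nat_of_bool; split.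
- by move=> [] _.
- by move=> [] [] _ _.
- by case=> [|[|n]]//= _; [exists false|exists true].
Qed.

Lemma simple_function_bool (X : bool -> H) : simple_function X.
Proof. by split; [exact/finite_image/finite_finset|]. Qed.

Section Bernoulli.
Variables (q : R) (q01 : 0 <= q <= 1).
Let P : probability bool R := bernoulli_prob q.

Lemma integrable_bool (f : bool -> R) : P.-integrable [set: bool] (EFin \o f).
Proof.
apply: measurable_bounded_integrable => //.
  by rewrite (le_lt_trans (probability_le1 P measurableT))// ltry.
exists (`|f true| + `|f false|); split; first exact: num_real.
move=> M /ltW fM [] _ /=; rewrite (le_trans _ fM)//.
  by rewrite lerDl.
by rewrite lerDr.
Qed.

(** The formula for nonnegative functions is applied after adding a constant. *)
Lemma Rintegral_bool (f : bool -> R) :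
  \int[P]_x f x = q * f true + (1 - q) * f false.
Proof.
pose M := `|f true| + `|f false|.
have gen (g : bool -> R) : (forall x, 0 <= g x) ->
    \int[P]_x g x = q * g true + (1 - q) * g false.
  by move=> g0; rewrite /Rintegral integral_bernoulli_prob.
have fM0 x : 0 <= f x + M.
  rewrite /M -lerBlDl sub0r; case: x.
    by rewrite (le_trans (ler_norm _))// normrN lerDl.
  by rewrite (le_trans (ler_norm _))// normrN lerDr.
have M0 : 0 <= M by rewrite addr_ge0.
have := gen _ fM0; rewrite RintegralD//; try exact: integrable_bool.
rewrite (gen (fun=> M))// => E; apply: (addIr (q * M + (1 - q) * M)).
by rewrite E; ring.
Qed.

End Bernoulli.

Section OnALine.
Variables (e : H) (q : R) (q01 : 0 <= q <= 1).
Let P : probability bool R := bernoulli_prob q.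

Lemma bochner_expectation_bool (u v : R) :
  bochner_expectation P (fun x => (if x then u else v) *: e)
    = (q * u + (1 - q) * v) *: e.
Proof.
apply: (dot_inj dotH) => h; rewrite (bochner_expectation_dot dotH).
- by rewrite Rintegral_bool// !dotZl; ring.
- exact/strongly_measurable_simple/simple_function_bool.
- exact: integrable_bool.
Qed.

End OnALine.

End TwoPoint.

Section SharpnessOnALine.
Context (R : realType) (H : completeNormedModType R).
Variables (dot : {dot H for idfun}) (dotH : hilbert_dot dot).
Variables (p tau : R) (p_gt1 : 1 < p) (p_le2 : p <= 2) (tau_gt0 : 0 < tau).
Variables (alpha beta : R) (alpha_ge0 : 0 <= alpha) (beta_ge0 : 0 <= beta).
Variables (e : H) (e1 : `|e| = 1).

Let p_gt0 : 0 < p. Proof. exact: lt_trans p_gt1. Qed.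

(** The centred variable with values a * e and - c * e of probabilities q and
    1 - q. Only the first value may be clipped, and the variance of the clipped
    variable is q * (1 - q) * (a' + c) ^ 2. *)
Lemma two_point_ratio (q a c : R) : 0 < q < 1 -> 0 < a -> 0 < c ->
  c <= tau -> q * a = (1 - q) * c ->
  let a' := Num.min a tau in
  let mu := q * a' - (1 - q) * c in
  two_point_clipping_ratios H p tau alpha beta
    ((alpha * `|mu|
        + beta * tau^-1 * (q * (1 - q) * (a' + c) ^+ 2))
      / (tau `^ (1 - p) * (q * a `^ p + (1 - q) * c `^ p)))%:E.
Proof.
move=> /andP[q0 q1] a0 c0 ct qac a' mu.
have q01 : 0 <= q <= 1 by rewrite !ltW.
pose P : probability bool R := bernoulli_prob q.
pose X (x : bool) := (if x then a else - c) *: e.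
have a'0 : 0 <= a' by rewrite le_min !ltW.
have MX : moment P p X = (q * a `^ p + (1 - q) * c `^ p)%:E.
  rewrite /moment expectation_Rintegral ?Rintegral_bool//; last first.
    exact: integrable_bool.
  by rewrite /X !normrZ e1 !mulr1 normrN !gtr0_norm.
have YE : clip tau \o X = fun x => (if x then a' else - c) *: e.
  apply/funext => -[] /=; rewrite /clip /X normrZ e1 mulr1.
    rewrite gtr0_norm// /a'; case: leP => // ta.
    by rewrite scalerA divfK// gt_eqF.
  by rewrite normrN gtr0_norm// ct.
exists _, _, P, X; split.
- exact: two_point_bool.
- split.
  + exact/strongly_measurable_simple/simple_function_bool.
  + by rewrite (bochner_expectation_bool dotH)// mulrN qac subrr scale0r.
  + rewrite MX lte_fin addr_gt0// mulr_gt0 ?powR_gt0// subr_gt0//.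
  + by rewrite MX ltry.
rewrite /clipping_ratio YE (bochner_expectation_bool dotH)// mulrN -/mu.
rewrite MX normrZ e1 mulr1.
have -> : fine ('E_P[(fun x : bool => `|(if x then a' else - c) *: e - mu *: e| ^+ 2)%R])%E
    = q * (1 - q) * (a' + c) ^+ 2.
  rewrite expectation_Rintegral; last exact: integrable_bool.
  rewrite /= Rintegral_bool// -!scalerBl !normrZ e1 !mulr1.
  by rewrite !(real_normK (num_real _)) /mu; ring.
by [].
Qed.

(** The symmetric variable with values tau * e and - tau * e is not clipped, so
    only the variance contributes. *)
Lemma subcritical_ratio : alpha <= p * beta ->
  two_point_clipping_ratios H p tau alpha beta (K_ p alpha beta)%:E.
Proof.
move=> ab; have half : 0 < (2^-1 : R) < 1 by apply/andP; split; lra.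
have half' : 2^-1 * tau = (1 - 2^-1) * tau by field.
have := two_point_ratio half tau_gt0 tau_gt0 (lexx tau) half'.
rewrite /= minxx -half' subrr normr0 mulr0 add0r -mulrDl.
rewrite (_ : 2^-1 + (1 - 2^-1) = 1); last by field.
rewrite mul1r -powRD ?subrK ?powRr1 ?(gt_eqF tau_gt0) ?implybT ?(ltW tau_gt0)//.
by rewrite /K_ ab (_ : _ / _ = beta)//; field; rewrite gt_eqF.
Qed.

(** The upper atom is placed at tau * r. With x = q / (1 - q), the lower one is
    at x * tau * r, and its share of the moment is x `^ (p - 1) times that of
    the upper atom. Dropping a nonnegative part of the variance and choosing x
    so small that x and x `^ (p - 1) are at most eps gives the bound. *)
Lemma supercritical_ratio_bound (S eps : R) : p * beta < alpha ->
  (forall s, two_point_clipping_ratios H p tau alpha beta s%:E -> s <= S) ->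
  0 < eps < 1 ->
  alpha * (contact_radius p alpha beta - 1) + beta * (1 - eps)
    <= S * contact_radius p alpha beta `^ p * (1 + eps).
Proof.
move=> ab Sub /andP[eps0 eps1]; set r := contact_radius p alpha beta.
have r1 : 1 < r by exact: contact_radius_gt1.
have r0 : 0 < r by exact: lt_trans r1.
have p1 : 0 < p - 1 by rewrite subr_gt0.
(* The bound r^-1 keeps the lower atom unclipped; the last one is
   x `^ (p - 1) <= eps. *)
pose x := Num.min eps (Num.min r^-1 (eps `^ (p - 1)^-1)).
have x0 : 0 < x by rewrite !lt_min eps0 invr_gt0 r0 powR_gt0.
have xe : x <= eps by rewrite ge_min lexx.
have xr : x * r <= 1.
  by rewrite -ler_pdivlMr// mul1r !ge_min lexx orbT.
have xp : x `^ (p - 1) <= eps.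
  have epsE : eps = (eps `^ (p - 1)^-1) `^ (p - 1).
    by rewrite -powRrM mulVf ?gt_eqF// powRr1// ltW.
  rewrite [leRHS]epsE.
  apply: ge0_ler_powR; rewrite ?nnegrE ?powR_ge0 ?(ltW x0) ?(ltW p1)//.
  by rewrite !ge_min lexx !orbT.
pose q := x / (1 + x).
have x10 : 0 < 1 + x by rewrite addr_gt0.
have q0 : 0 < q by rewrite divr_gt0.
have qx : q <= x by rewrite ler_pdivrMr// ler_peMr ?lerDl// ltW.
have q1 : q < 1 by rewrite ltr_pdivrMr// mul1r ltrDr.
have qE : (1 - q) * x = q by rewrite /q; field; rewrite gt_eqF.
clearbody q.
have qq : 0 < q < 1 by rewrite q0.
have a0 : 0 < tau * r by rewrite mulr_gt0.
have c0 : 0 < x * (tau * r) by rewrite mulr_gt0.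
have ct : x * (tau * r) <= tau.
  by rewrite mulrCA -[leRHS]mulr1 ler_pM2l.
have qac : q * (tau * r) = (1 - q) * (x * (tau * r)) by rewrite (mulrA (1 - q)) qE.
have /Sub := two_point_ratio qq a0 c0 ct qac.
rewrite /= (min_idPr _); last by rewrite -[leLHS]mulr1 ler_pM2l// ltW.
rewrite -qac ler_pdivrMr; last first.
  by rewrite mulr_gt0 ?powR_gt0// addr_gt0// mulr_gt0 ?powR_gt0// subr_gt0.
have -> : q * tau - q * (tau * r) = - (q * tau * (r - 1)) by ring.
rewrite normrN ger0_norm; last by rewrite mulr_ge0 ?subr_ge0 ?(ltW r1) ?(ltW (mulr_gt0 q0 _)).
have -> : tau `^ (1 - p) * (q * (tau * r) `^ p + (1 - q) * (x * (tau * r)) `^ p)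
    = q * tau * (r `^ p * (1 + x `^ (p - 1))).
  have xpE : x `^ p = x * x `^ (p - 1) by rewrite mulr_powRB1// ltW.
  have tE : tau `^ (1 - p) * tau `^ p = tau.
    by rewrite -powRD ?subrK ?powRr1 ?(gt_eqF tau_gt0) ?implybT// ltW.
  rewrite (powRM _ (ltW x0) (ltW a0)) (powRM _ (ltW tau_gt0) (ltW r0)) xpE.
  transitivity (tau `^ (1 - p) * tau `^ p * r `^ p *
      (q + (1 - q) * x * x `^ (p - 1))); first by ring.
  by rewrite tE qE; ring.
move=> le1.
have le2 : alpha * (r - 1) + beta * (1 - q) <= S * (r `^ p * (1 + x `^ (p - 1))).
  have qt : 0 < q * tau by rewrite mulr_gt0.
  rewrite -(ler_pM2l qt) [leRHS]mulrCA; apply: le_trans le1.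
  rewrite mulrDr lerD//; first by rewrite mulrCA.
  have -> : q * tau * (beta * (1 - q)) =
      beta * tau^-1 * (q * (1 - q) * tau ^+ 2) by field; rewrite gt_eqF.
  rewrite ler_wpM2l ?mulr_ge0 ?invr_ge0 ?(ltW tau_gt0)//.
  rewrite ler_wpM2l ?mulr_ge0 ?subr_ge0 ?(ltW q0) ?(ltW q1)//.
  rewrite lerXn2r ?nnegrE ?addr_ge0 ?(ltW tau_gt0) ?(ltW c0)//.
  by rewrite lerDl ltW.
(* The sign is needed to replace x `^ (p - 1) by eps. *)
have Sr0 : 0 <= S * r `^ p.
  rewrite -(pmulr_lge0 _ (_ : 0 < 1 + x `^ (p - 1))); last first.
    by rewrite addr_gt0// powR_gt0.
  rewrite -mulrA; apply: le_trans le2.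
  by rewrite addr_ge0// mulr_ge0// subr_ge0 ltW.
apply: (@le_trans _ _ (alpha * (r - 1) + beta * (1 - q))).
  by rewrite lerD2l ler_wpM2l// lerD2l lerN2 (le_trans qx).
by rewrite (le_trans le2)// mulrA ler_wpM2l// lerD2l.
Qed.

(** Let eps tend to 0 in [supercritical_ratio_bound]; the limit is
    K * r `^ p <= S * r `^ p. *)
Lemma supercritical_sup (S : R) : p * beta < alpha ->
  (forall s, two_point_clipping_ratios H p tau alpha beta s%:E -> s <= S) ->
  K_ p alpha beta <= S.
Proof.
move=> ab Sub; set r := contact_radius p alpha beta.
have r0 : 0 < r by apply: lt_trans (contact_radius_gt1 p_gt1 beta_ge0 ab).
rewrite -(ler_pM2r (powR_gt0 p r0)) K_contact// -/r.
apply/ler_addgt0Pr => dlt dlt0.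
have N0 : 0 < `|S * r `^ p| + beta + 1 by rewrite ltr_wpDl// addr_ge0.
pose eps := Num.min 2^-1 (dlt / (`|S * r `^ p| + beta + 1)).
have eps01 : 0 < eps < 1.
  apply/andP; split; first by rewrite lt_min invr_gt0 ltr0n divr_gt0.
  by rewrite gt_min invf_lt1// ltr1n.
have := supercritical_ratio_bound ab Sub eps01; rewrite -/r => le1.
have epse : eps * (`|S * r `^ p| + beta + 1) <= dlt.
  by rewrite -ler_pdivlMr// ge_min lexx orbT.
have SS : eps * (S * r `^ p) <= eps * `|S * r `^ p|.
  by rewrite ler_wpM2l ?ler_norm// ltW//; case/andP: eps01.
by case/andP: eps01 => [? _]; move: le1 epse SS; nra.
Qed.

Lemma two_point_sup_ge (S : R) :
  (forall s, two_point_clipping_ratios H p tau alpha beta s%:E -> s <= S) ->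
  K_ p alpha beta <= S.
Proof.
have [ab|ab] := leP alpha (p * beta); last exact: supercritical_sup.
by move=> Sub; apply: Sub; exact: subcritical_ratio.
Qed.

End SharpnessOnALine.

(** * The supremum of the ratios *)

Section Ratio.
Context (R : realType) (H : completeNormedModType R).
Variables (dot : {dot H for idfun}) (dotH : hilbert_dot dot).
Variables (p tau : R) (p_gt1 : 1 < p) (p_le2 : p <= 2) (tau_gt0 : 0 < tau).
Variables (alpha beta : R) (alpha_ge0 : 0 <= alpha) (beta_ge0 : 0 <= beta).
Context d (T : measurableType d) (P : probability T R) (X : T -> H).
Hypothesis cX : centered_nontrivial p P X.

Let LpX : in_bochner_Lp P p X. Proof. by case: cX. Qed.
Let m0 : bochner_expectation P X = 0. Proof. by case: cX. Qed.

Let M := \int[P]_w `|X w| `^ p.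
Let b := bochner_expectation P (clip tau \o X).

Let M_gt0 : 0 < M.
Proof. by case: cX => _ _ + _; rewrite moment_Rintegral// lte_fin. Qed.

Lemma clipping_ratioE : clipping_ratio p tau alpha beta P X =
  (alpha * `|b - bochner_expectation P X|
     + beta / tau * \int[P]_w (`|(clip tau \o X) w - b| ^+ 2))
  / (tau `^ (1 - p) * M).
Proof.
rewrite /clipping_ratio moment_Rintegral// expectation_Rintegral.
  by rewrite m0 subr0.
exact: variance_clip_integrable LpX.
Qed.

Let D_gt0 : 0 < tau `^ (1 - p) * M.
Proof. by rewrite mulr_gt0// powR_gt0. Qed.

Lemma clipping_ratio_le : clipping_ratio p tau alpha beta P X <= K_ p alpha beta.
Proof.
rewrite clipping_ratioE ler_pdivrMr// mulrA.
exact: (clipping_inequality dotH).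
Qed.

Lemma clipping_ratio_lt : p * beta < alpha ->
  clipping_ratio p tau alpha beta P X < K_ p alpha beta.
Proof.
move=> ab; rewrite clipping_ratioE ltr_pdivrMr// mulrA.
exact: (clipping_inequality_strict dotH).
Qed.

End Ratio.

Lemma ereal_sup_EFin (R : realType) (A : set (\bar R)) (K : R) :
  (forall r, A r -> (r <= K%:E)%E) ->
  (forall S : R, (forall s, A s%:E -> s <= S) -> K <= S) ->
  ereal_sup A = K%:E.
Proof.
move=> AK KA; apply/eqP; rewrite eq_le ge_ereal_sup/=; last first.
  by move=> r /AK.
case supA : (ereal_sup A) => [S| |]; rewrite ?leey//.
  rewrite lee_fin; apply: KA => s As; rewrite -lee_fin -supA.
  exact: ereal_sup_ubound.
(* The supremum of the empty set is -oo; then every S is an upper bound. *)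
have : K <= K - 1.
  by apply: KA => s /ereal_sup_ubound; rewrite supA.
by rewrite lerBrDr gerDl ler10.
Qed.

Theorem theorem3p1 (R : realType) (H : completeNormedModType R)
    (dot : {dot H for idfun}) (dotH : hilbert_dot dot)
    (H_neq0 : exists x : H, x != 0)
    (p tau : R) (p_gt1 : 1 < p) (p_le2 : p <= 2) (tau_gt0 : 0 < tau) :
  [/\ (forall (d : measure_display) (T : measurableType d)
         (P : probability T R) (X : T -> H),
         in_bochner_Lp P p X ->
         let Y := clip tau \o X in
         let m := bochner_expectation P X in
         let b := bochner_expectation P Y in
         forall alpha beta : R, 0 <= alpha -> 0 <= beta ->
         ((alpha * `|b - m|)%:E
            + (beta / tau)%:E * 'E_P[(fun w => `|Y w - b| ^+ 2)%R]
          <= (K_ p alpha beta * tau `^ (1 - p))%:E * moment P p X)%E),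
      (forall alpha beta : R, 0 <= alpha -> 0 <= beta ->
         ereal_sup (clipping_ratios H p tau alpha beta)
           = (K_ p alpha beta)%:E /\
         ereal_sup (two_point_clipping_ratios H p tau alpha beta)
           = (K_ p alpha beta)%:E)
    & (forall alpha beta : R, 0 <= alpha -> 0 <= beta -> p * beta < alpha ->
         forall (d : measure_display) (T : measurableType d)
           (P : probability T R) (X : T -> H),
         centered_nontrivial p P X ->
         clipping_ratio p tau alpha beta P X <> K_ p alpha beta)].
Proof.
(* The extremal variables live on the line spanned by a unit vector. *)
have [x0 x0_neq0] := H_neq0.
pose e := `|x0|^-1 *: x0.
have e1 : `|e| = 1.
  by rewrite normrZ ger0_norm ?invr_ge0// mulVf// normr_eq0.
split.
- move=> d T P X LpX Y m b alpha beta alpha_ge0 beta_ge0.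
  rewrite (moment_Rintegral LpX) expectation_Rintegral; last first.
    exact: variance_clip_integrable LpX.
  by rewrite -!EFinM -EFinD lee_fin; exact: (clipping_inequality dotH).
- move=> alpha beta alpha_ge0 beta_ge0.
  have ubK (r : \bar R) : clipping_ratios H p tau alpha beta r ->
      (r <= (K_ p alpha beta)%:E)%E.
    move=> [d [T [P [X [cX ->]]]]]; rewrite lee_fin.
    exact: (clipping_ratio_le dotH).
  have sub : two_point_clipping_ratios H p tau alpha beta `<=`
      clipping_ratios H p tau alpha beta.
    by move=> r [d [T [P [X [_ cX rE]]]]]; exists d, T, P, X.
  have lbK (S : R) : (forall s, two_point_clipping_ratios H p tau alpha beta
      s%:E -> s <= S) -> K_ p alpha beta <= S.
    exact: (two_point_sup_ge dotH p_gt1 tau_gt0 alpha_ge0 beta_ge0 e1).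
  split; apply: ereal_sup_EFin => //.
    by move=> S ubS; apply: lbK => s /sub; exact: ubS.
  by move=> r /sub; exact: ubK.
- move=> alpha beta alpha_ge0 beta_ge0 ab d T P X cX; apply/eqP.
  by rewrite lt_eqF//; exact: (clipping_ratio_lt dotH).
Qed.
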